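(* Let $q(z)$ and $\widehat q(z)$ be two rational functions in barycentric forms: $$q(z)=\sum_{k=1}^K\frac{w_k}{z-z_k}\quad\text{and}\quad\widehat q(z)=\sum_{k=1}^K\frac{\widehat w_k}{z-z_k},$$ where $|\widehat w_k-w_k|=\mathcal{O}(\mathbf{u})$ for all $1\le k\le K$ and $\sum_{k=1}^K|w_k|^2=1$. Let $\lambda_i\in\mathbb{C}\setminus\{z_1,\dots,z_K\}$ be a root of $q$ with multiplicity $m_{i,1}$. Then there exist $m_{i,1}$ roots $\widehat\lambda_{i,j}$ ($1\le j\le m_{i,1}$) of $\widehat q$ such that $$\widehat\lambda_{i,j}=\lambda_i+\mathcal{O}(\kappa_i\mathbf{u}^{1/m_{i,1}}),$$ where $\kappa_i$ is defined via $$\kappa_i^{-m_{i,1}}:=\min_{1\le k\le K}|\lambda_i-z_k|\cdot\Bigl|\sum_{k=1}^K\frac{w_k}{(\lambda_i-z_k)^{m_{i,1}+1}}\Bigr|=\min_{1\le k\le K}|\lambda_i-z_k|\cdot\Bigl|\frac{q^{(m_{i,1})}(\lambda_i)}{m_{i,1}!}\Bigr|.$$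
   Context: $z_1,\dots,z_K\in\mathbb{C}$ are support points and $w_k,\widehat w_k\in\mathbb{C}$ are weights. $\mathbf{u}$ is the machine precision (unit roundoff), treated as a small parameter: the statement is a first-order perturbation result as $\mathbf{u}\to0$ with $q$ fixed. $a=\mathcal{O}(b)$ means $|a|\le c|b|$ for a positive constant $c$ (independent of $\mathbf{u}$). $q^{(k)}$ is the $k$th derivative. Roots are counted with multiplicity. *)

(* Defs.v *)
From HB Require Import structures.
From mathcomp Require Import all_boot all_order all_algebra complex.
From mathcomp Require Import all_classical all_reals all_analysis.

Set Implicit Arguments.
Unset Strict Implicit.
Unset Printing Implicit Defensive.

Import Order.TTheory GRing.Theory Num.Theory.
Import numFieldNormedType.Exports.

Local Open Scope ring_scope.

(* [Normc.normc x] is the complex modulus with values in [R], whereas [`|x|]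
   is the same number seen as an element of [R[i]]. *)
Notation cmod := Normc.normc.

Section Barycentric.
Variables (R : realType) (K : nat).
Implicit Types (z w : 'I_K -> R[i]) (x lam : R[i]) (m : nat).

Definition bary z w x : R[i] := \sum_(k < K) w k / (x - z k).

Definition bary_num z w : {poly R[i]} :=
  \sum_(k < K) w k *: \prod_(j < K | j != k) ('X - (z j)%:P).

Definition bary_den z : {poly R[i]} := \prod_(k < K) ('X - (z k)%:P).

(* Multiplicity of [x] as a root of the rational function
   [bary_num z w / bary_den z]; it is 0 when [x] is not a root.  The fraction
   need not be reduced (e.g. when some [w k = 0]), so the order of the
   denominator is subtracted; the truncated subtraction is 0 at a pole. *)
Definition root_mult z w x : nat :=
  (mup x (bary_num z w) - mup x (bary_den z))%N.

(* The initial value of the iterated minimum is an element of the list, so this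
   is the minimum over [k] of [cmod (lam - z k)] as soon as [0 < K]. *)
Definition min_dist z lam : R :=
  let s := [seq cmod (lam - z k) | k : 'I_K] in
  \big[Num.min/head 0 s]_(d <- s) d.

Definition cond_sum z w lam m : R[i] :=
  \sum_(k < K) w k / (lam - z k) ^+ m.+1.

Definition kappa z w lam m : R :=
  (min_dist z lam * cmod (cond_sum z w lam m)) `^ (- m%:R^-1).

Lemma bary_denN0 z : bary_den z != 0.
Proof. by apply/prodf_neq0 => k _; rewrite polyXsubC_eq0. Qed.

Lemma baryE z w x : (forall k, x != z k) ->
  bary z w x = (bary_num z w).[x] / (bary_den z).[x].
Proof.
move=> xz; have xzN0 j : x - z j != 0 by rewrite subr_eq0.
rewrite /bary_num horner_sum mulr_suml; apply: eq_bigr => k _.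
have -> : (bary_den z).[x]
    = (x - z k) * (\prod_(j < K | j != k) ('X - (z j)%:P)).[x].
  by rewrite /bary_den (bigD1 k)//= hornerM hornerXsubC.
rewrite hornerZ -mulrA; congr (_ * _).
rewrite invfM mulrCA divff ?mulr1// horner_prod.
by apply/prodf_neq0 => j _; rewrite hornerXsubC.
Qed.

Lemma root_mult_gt0 z w x : (forall k, x != z k) -> bary_num z w != 0 ->
  (0 < root_mult z w x)%N = (bary z w x == 0).
Proof.
move=> xz N0; have denx : (bary_den z).[x] != 0.
  rewrite horner_prod; apply/prodf_neq0 => k _.
  by rewrite hornerXsubC subr_eq0.
rewrite /root_mult (@mupNroot _ x (bary_den z))// subn0 -XsubC_dvd//.
by rewrite dvdp_XsubCl baryE// mulf_eq0 invr_eq0 (negbTE denx) orbF.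
Qed.

End Barycentric.

(* Main.v *)
(* Write the shifted perturbed numerator as p(t) = sum_j p_j t^j.  Rouche's
   theorem is replaced by a coefficient inequality: if fewer than m roots of p
   have modulus at most r, then
     |p_m| r^m <= (m+1)^(deg p) sum_(j < m) |p_j| r^j,
   which follows by dividing out one by one the linear factors whose root is
   larger than r.  At a root of multiplicity m of q, expanding 1/(t + lam - z_k)
   shows that |p_m| tends to |D(lam)| |cond_sum|, that p_j = O(u) for j < m, and
   that |p_0| <= |D(lam)| K C u / min_dist, where D is the denominator.  With
   r = c kappa u^(1/m) the terms 0 < j < m are o(u), so the inequality fails for
   small u once c is large in terms of K and C only. *)
Require Import Defs.
From mathcomp Require Import all_boot all_order all_algebra complex.
From mathcomp Require Import all_classical all_reals all_analysis.
From mathcomp Require Import ring lra.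
Import Order.TTheory GRing.Theory Num.Theory.
Import numFieldNormedType.Exports.
Local Open Scope classical_set_scope.
Local Open Scope ring_scope.

(** * The complex modulus with real values *)

Lemma cmod_ge0 {R : realType} (x : R[i]) : 0 <= cmod x.
Proof. by case: x => a b; exact: sqrtr_ge0. Qed.

Lemma ler_cmodD {R : realType} (x y : R[i]) : cmod (x + y) <= cmod x + cmod y.
Proof. exact: le_normcD. Qed.

Lemma cmodN {R : realType} (x : R[i]) : cmod (- x) = cmod x.
Proof. exact: normcN. Qed.

Lemma ler_cmodB {R : realType} (x y : R[i]) : cmod (x - y) <= cmod x + cmod y.
Proof. by rewrite -(cmodN y); exact: ler_cmodD. Qed.

Lemma cmod_gt0 {R : realType} (x : R[i]) : (0 < cmod x) = (x != 0).
Proof.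
rewrite lt_def cmod_ge0 andbT; congr (~~ _).
by apply/eqP/eqP => [/Normc.eq0_normc|->]; last exact: Normc.normc0.
Qed.

Lemma cmodX {R : realType} (x : R[i]) n : cmod (x ^+ n) = cmod x ^+ n.
Proof.
elim: n => [|n IHn]; first by rewrite !expr0 Normc.normc1.
by rewrite !exprS Normc.normcM IHn.
Qed.

Lemma ler_cmod_sum {R : realType} {I : Type} (s : seq I) (F : I -> R[i]) :
  cmod (\sum_(i <- s) F i) <= \sum_(i <- s) cmod (F i).
Proof.
elim: s => [|i s IHs]; first by rewrite !big_nil Normc.normc0.
by rewrite !big_cons (le_trans (ler_cmodD _ _))// lerD2l.
Qed.

(** * A coefficient inequality for products of linear factors with large roots *)

Lemma coefM_XsubC {A : comNzRingType} (p : {poly A}) x j :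
  (p * ('X - x%:P))`_j = (if j == 0%N then 0 else p`_j.-1) - p`_j * x.
Proof. by rewrite mulrBr coefB coefMX coefMC. Qed.

(** Each factor whose root has modulus at least [r] costs one factor [m.+1] in the induction on [s]:
    the low coefficients before the multiplication are controlled by those after it. *)
Lemma coef_mul_large_roots {R : realType} (r : R) (m : nat) (p : {poly R[i]})
    (s : seq R[i]) :
  0 < r -> (0 < m)%N -> p`_m = 0 -> (forall x, x \in s -> r <= cmod x) ->
  cmod (p * \prod_(x <- s) ('X - x%:P))`_m * r ^+ m
    <= m.+1%:R ^+ size s
       * \sum_(j < m) cmod (p * \prod_(x <- s) ('X - x%:P))`_j * r ^+ j.
Proof.
move=> r0 m0 pm; elim: s => [|x s IHs] rs.
  rewrite big_nil mulr1 pm Normc.normc0 mul0r mulr_ge0 ?exprn_ge0//.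
  by apply: sumr_ge0 => i _; rewrite mulr_ge0 ?cmod_ge0// exprn_ge0// ltW.
have rx : r <= cmod x by apply: rs; rewrite mem_head.
have {}IHs := IHs (fun y ys => rs y (mem_behead (s := x :: s) ys)).
have -> : p * \prod_(y <- x :: s) ('X - y%:P)
  = (p * \prod_(y <- s) ('X - y%:P)) * ('X - x%:P).
  by rewrite big_cons mulrCA mulrC.
move: (p * _) IHs => q IHs.
set q' := q * _; pose S j := \sum_(i < j) cmod q'`_i * r ^+ i.
have r1 j : 0 <= r ^+ j by rewrite exprn_ge0// ltW.
have term_ge0 j : 0 <= cmod q'`_j * r ^+ j by rewrite mulr_ge0 ?cmod_ge0.
have S_mono i j : (i <= j)%N -> S i <= S j.
  move=> /subnK <-; elim: (j - i)%N => [//|k IHk].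
  by rewrite addSn (le_trans IHk)// /S big_ord_recr/= lerDl.
(* Since [x * q_j = q_(j-1) - q'_j], the bound at index [j - 1] passes to [j], with [r <= cmod x]
   replacing one factor [cmod x] by [r]. *)
have M_le j : cmod x * cmod q`_j * r ^+ j <= S j.+1.
  elim: j => [|j IHj].
    rewrite /S big_ord_recr/= big_ord0 add0r /q' coefM_XsubC/= sub0r cmodN.
    by rewrite Normc.normcM [cmod q`_0 * _]mulrC.
  rewrite /S big_ord_recr/= -/(S j.+1).
  have -> : cmod x * cmod q`_j.+1 = cmod (q`_j - q'`_j.+1).
    by rewrite /q' coefM_XsubC/= subKr Normc.normcM mulrC.
  rewrite (le_trans (ler_wpM2r _ (ler_cmodB _ _)))// mulrDl lerD2r.
  rewrite exprS mulrCA mulrA (le_trans _ IHj)// ler_wpM2r//.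
  by rewrite ler_wpM2r ?cmod_ge0.
have M_leS j : (j < m)%N -> cmod x * cmod q`_j * r ^+ j <= S m.
  by move=> jm; rewrite (le_trans (M_le j))// S_mono.
have S0 : 0 <= S m by apply: sumr_ge0.
have top : cmod x * cmod q`_m * r ^+ m <= m.+1%:R ^+ size s * (m%:R * S m).
  rewrite -mulrA (le_trans (ler_wpM2l (cmod_ge0 _) IHs))//.
  rewrite mulrCA ler_wpM2l ?exprn_ge0// mulr_sumr.
  rewrite (le_trans (ler_sum _ (G := fun=> S m) _))//.
    by move=> i _; rewrite mulrA M_leS.
  by rewrite sumr_const card_ord mulr_natl.
case: m m0 pm IHs M_leS S0 top => // m _ _ _ M_leS S0 top.
rewrite {1}/q' coefM_XsubC/= (le_trans (ler_wpM2r _ (ler_cmodB _ _)))//.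
rewrite mulrDl Normc.normcM [cmod q`_m.+1 * _]mulrC.
have : cmod q`_m * r ^+ m.+1 <= S m.+1.
  rewrite exprS mulrCA mulrA (le_trans _ (M_leS m _))// ler_wpM2r//.
  by rewrite ler_wpM2r ?cmod_ge0.
move=> /lerD /(_ top) /le_trans -> //.
(* With [A] the power for [s] and [M] the original [m], the two bounds sum to [S M + A * M * S M];
   the first term is absorbed by [1 <= A]. *)
rewrite -/(S m.+1) exprSr -mulrA -[m.+2%:R]natr1 [(_ + 1) * S _]mulrDl mul1r.
rewrite mulrDr [X in X <= _]addrC lerD2l ler_peMl//.
by rewrite exprn_ege1// lerDr.
Qed.

(** * Taylor coefficients of the numerator and the sums [cond_sum] *)

Lemma bary_den_neq0 {R : realType} {K : nat} (z : 'I_K -> R[i]) x :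
  (forall k, x != z k) -> (bary_den z).[x] != 0.
Proof.
move=> xz; rewrite horner_prod; apply/prodf_neq0 => k _.
by rewrite hornerXsubC subr_eq0.
Qed.

Lemma root_multE {R : realType} {K : nat} (z w : 'I_K -> R[i]) x :
  (forall k, x != z k) -> root_mult z w x = mup x (bary_num z w).
Proof.
move=> xz; rewrite /root_mult (@mupNroot _ x (bary_den z)) ?subn0//.
by rewrite /root bary_den_neq0.
Qed.

Lemma coef0_shift {A : comNzRingType} (p : {poly A}) x :
  (p \Po ('X + x%:P))`_0 = p.[x].
Proof. by rewrite -horner_coef0 horner_comp !hornerE. Qed.

(** The shift turns the factor [('X - x%:P) ^+ m] into ['X^m], and the cofactor cannot vanish at [x]
    because [m] is the largest such exponent. *)
Lemma coef_shift_mup {F : fieldType} (p : {poly F}) x (m := mup x p) :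
  p != 0 -> (forall j, (j < m)%N -> (p \Po ('X + x%:P))`_j = 0)
    /\ (p \Po ('X + x%:P))`_m != 0.
Proof.
move=> p0; have /dvdpP[q pE] : ('X - x%:P) ^+ m %| p by rewrite -mup_geq.
have sE : p \Po ('X + x%:P) = (q \Po ('X + x%:P)) * 'X^m.
  by rewrite pE rmorphM rmorphXn/= comp_polyB comp_polyX comp_polyC addrK.
split=> [j jm|]; rewrite sE coefMXn ?jm// ltnn subnn coef0_shift.
apply/negP => /(factor_theorem q x)[q' qE].
have := leqnn m; rewrite {1}/m mup_leq// => /negP; apply.
by rewrite pE qE -mulrA -exprS dvdp_mull.
Qed.

(** A polynomial form of the geometric expansion of [1 / (t + lam - z k)], multiplied through by the
    denominator and kept finite by an explicit remainder. *)
Lemma coef_shift_bary_num {R : realType} {K : nat} (z w : 'I_K -> R[i]) lam n :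
  (forall k, lam != z k) ->
  (forall i, (i < n)%N -> cond_sum z w lam i = 0) ->
  (bary_num z w \Po ('X + lam%:P))`_n
    = (bary_den z).[lam] * ((-1) ^+ n * cond_sum z w lam n).
Proof.
move=> lz; set s := 'X + lam%:P.
have b0 k : lam - z k != 0 by rewrite subr_eq0.
pose Dk k := (\prod_(j < K | j != k) ('X - (z j)%:P)) \Po s.
pose D := bary_den z \Po s.
have DE k : D = 'X * Dk k + (lam - z k) *: Dk k.
  rewrite /D /bary_den (bigD1 k)//= comp_polyM -/(Dk k).
  rewrite comp_polyB comp_polyX comp_polyC /s -addrA -polyCB mulrDl.
  by rewrite mul_polyC.
have DkE k : Dk k = (lam - z k)^-1 *: (D - 'X * Dk k).
  by rewrite (DE k) addrAC subrr add0r scalerA mulVf// scale1r.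
(* [Q i] is the remainder after [i] steps of the expansion; the multiple of [D] split off from it
   vanishes when [cond_sum] of index [i] does. *)
pose Q n := \sum_(k < K) ((-1) ^+ n * (w k / (lam - z k) ^+ n)) *: Dk k.
have QS i : Q i = ((-1) ^+ i * cond_sum z w lam i) *: D + 'X * Q i.+1.
  rewrite /cond_sum mulr_sumr scaler_suml /Q mulr_sumr -big_split/=.
  apply: eq_bigr => k _; rewrite {1}DkE scalerA scalerBr -scalerAr.
  congr (_ + _); first by congr (_ *: _); rewrite exprSr invfM; ring.
  rewrite -scaleNr; congr (_ *: _); rewrite !exprS invfM; ring.
have Q0 : bary_num z w \Po s = Q 0%N.
  rewrite /bary_num rmorph_sum/=; apply: eq_bigr => k _.
  by rewrite comp_polyZ mul1r expr0 divr1.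
move=> e0.
have -> : bary_num z w \Po s = 'X^n * Q n.
  elim: n e0 => [|n IHn] e0; first by rewrite mul1r.
  rewrite IHn; last by move=> i /ltnW/e0.
  by rewrite QS e0// mulr0 scale0r add0r mulrA -exprSr.
rewrite coefXnM ltnn subnn QS coefD coefXM addr0 coefZ coef0_shift.
by rewrite mulrC.
Qed.

(** Strong induction: once the sums of smaller index vanish, the Taylor coefficient of index [i] is
    [cond_sum] of index [i] times a nonzero factor. *)
Lemma cond_sum_root_mult {R : realType} {K : nat} (z w : 'I_K -> R[i]) lam m :
  (forall k, lam != z k) -> (0 < m)%N -> root_mult z w lam = m ->
  (forall i, (i < m)%N -> cond_sum z w lam i = 0)
    /\ cond_sum z w lam m != 0.
Proof.
move=> lz m0; rewrite root_multE// => mE.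
have N0 : bary_num z w != 0.
  (* [mup] is a maximum over exponents bounded by the size, hence 0 at the zero polynomial. *)
  apply: contraL m0 => /eqP N0; rewrite -mE N0 /mup; case: arg_maxnP => //.
  by case=> i /=; rewrite size_poly0 ltnS -leqNgt.
have [cj cm] := coef_shift_mup _ lam N0; rewrite mE in cj cm.
have e0 i : (i < m)%N -> cond_sum z w lam i = 0.
  elim/ltn_ind: i => i IHi im.
  have := cj i im; rewrite coef_shift_bary_num//; last first.
    by move=> l li; rewrite IHi// (ltn_trans li).
  move/eqP; rewrite mulrA mulf_eq0 mulf_eq0 (negbTE (bary_den_neq0 _ _ lz))/=.
  by rewrite signr_eq0/= => /eqP.
split=> //; apply: contraNneq cm => em.
by rewrite coef_shift_bary_num// em !mulr0.
Qed.

(** * Derivatives of the barycentric form *)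

Lemma near_neq {R : realType} {K : nat} (z : 'I_K -> R[i]) (lam : R[i]^o) :
  (forall k, lam != z k) -> \forall x \near lam, forall k, x != z k.
Proof.
move=> lz; apply: (filter_forall (F := nbhs lam)) => k.
have e0 : 0 < `|lam - z k| by rewrite normr_gt0 subr_eq0.
apply: filterS (nbhsx_ballx lam _ e0) => x.
by rewrite -ball_normE/=; apply: contraTneq => ->; rewrite ltxx.
Qed.

Lemma is_derive_cond_sum {R : realType} {K : nat} (z w : 'I_K -> R[i]) m
    (lam : R[i]^o) :
  (forall k, lam != z k) ->
  is_derive lam (1 : R[i]^o) (fun x : R[i]^o => cond_sum z w x m : R[i]^o)
    (- (m.+1%:R * cond_sum z w lam m.+1)).
Proof.
move=> lz.
have Dg k : is_derive lam (1 : R[i]^o) (fun x : R[i]^o => (x - z k)^-1 : R[i]^o)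
    (- (lam - z k) ^- 2).
  have Df : is_derive lam (1 : R[i]^o) (fun x : R[i]^o => x - z k : R[i]^o) 1.
    by apply: is_derive_eq; rewrite subr0.
  have f0 : lam - z k != 0 by rewrite subr_eq0.
  apply: DeriveDef; first by apply: derivableV.
  by rewrite deriveV// derive_val [LHS]mulr1.
have := is_derive_sum (fun k => is_deriveZ (w k) (is_deriveX m.+1 (Dg k))).
rewrite [X in is_derive _ _ X _](_ : _
  = (fun x : R[i]^o => cond_sum z w x m : R[i]^o)); last first.
  apply/funext => x; rewrite fct_sumE; apply: eq_bigr => k _.
  by rewrite -exprVn [LHS]/GRing.scale/= exprfctE.
move=> S; apply: (is_derive_eq S).
rewrite mulr_sumr -sumrN; apply: eq_bigr => k _.
rewrite /GRing.scale/= [in RHS]exprSr [in RHS]exprSr !invfM -!exprVn.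
ring.
Qed.

(** Links the two expressions for [kappa]: differentiating [cond_sum] of index [m] brings out
    [- (m + 1)], whence the sign and the factorial. *)
Lemma derive1n_bary {R : realType} {K : nat} (z w : 'I_K -> R[i]) m lam :
  (forall k, lam != z k) ->
  (bary z w : R[i] -> R[i]^o)^`(m)%classic lam
    = (-1) ^+ m * (m`!)%:R * cond_sum z w lam m.
Proof.
elim: m lam => [|m IHm] lam lz.
  rewrite derive1n0 !mul1r /bary /cond_sum.
  by apply: eq_bigr => k _; rewrite expr1.
rewrite derive1nS derive1E.
(* The induction hypothesis holds off the poles, hence on a neighbourhood of [lam], as
   differentiating once more demands. *)
have near_lam : \forall x \near (lam : R[i]^o),
    (bary z w : R[i] -> R[i]^o)^`(m)%classic x
    = (((-1) ^+ m * (m`!)%:R)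
       *: (fun x : R[i]^o => cond_sum z w x m : R[i]^o)) x.
  by apply: filterS (near_neq _ _ lz) => x xz; rewrite IHm.
rewrite (near_eq_derive _ near_lam).
have D := is_derive_cond_sum z w m _ lz.
rewrite deriveZ; last exact: ex_derive.
rewrite derive_val factS natrM exprS.
rewrite /GRing.scale/=; ring.
Qed.

(** * The minimal distance and [kappa] *)

Lemma min_dist_le {R : realType} {K : nat} (z : 'I_K -> R[i]) lam k :
  min_dist z lam <= cmod (lam - z k).
Proof.
pose s := [seq cmod (lam - z k) | k : 'I_K]; rewrite /min_dist -/s.
have : cmod (lam - z k) \in s by apply/mapP; exists k; rewrite ?mem_enum.
elim: s (head 0 s) => [//|y s IHs] x0; rewrite inE big_cons ge_min => /orP[|].
  by move=> /eqP ->; rewrite lexx.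
by move=> /(IHs x0) ->; rewrite orbT.
Qed.

Lemma min_dist_gt0 {R : realType} {K : nat} (z : 'I_K -> R[i]) lam :
  (0 < K)%N -> (forall k, lam != z k) -> 0 < min_dist z lam.
Proof.
move=> K0 lz; pose s := [seq cmod (lam - z k) | k : 'I_K]; rewrite /min_dist -/s.
have s_gt0 x : x \in s -> 0 < x.
  by move=> /mapP[k _ ->]; rewrite cmod_gt0 subr_eq0.
have size_s : size s = K by rewrite size_image card_ord.
rewrite big_seq; elim/big_ind: _ => // [|x y x0 y0]; last by rewrite lt_min x0.
(* The initial value of the minimum: [0 < K] makes it an element of the list rather than the default
   0. *)
by apply: s_gt0; rewrite -nth0 mem_nth// size_s.
Qed.

Lemma kappa_gt0 {R : realType} {K : nat} (z w : 'I_K -> R[i]) lam m :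
  0 < min_dist z lam * cmod (cond_sum z w lam m) -> 0 < kappa z w lam m.
Proof. exact: powR_gt0. Qed.

Lemma kappaXn {R : realType} {K : nat} (z w : 'I_K -> R[i]) lam m :
  (0 < m)%N -> 0 < min_dist z lam * cmod (cond_sum z w lam m) ->
  kappa z w lam m ^+ m = (min_dist z lam * cmod (cond_sum z w lam m))^-1.
Proof.
move=> m0 X0; rewrite -powR_mulrn ?powR_ge0// /kappa -powRrM mulNr mulVf.
  by rewrite powR_inv1 ?ltW.
by rewrite pnatr_eq0 -lt0n.
Qed.

(** * Existence of [m] roots in a disc *)

Lemma size_bary_num {R : realType} {K : nat} (z w : 'I_K -> R[i]) :
  (size (bary_num z w) <= K.+1)%N.
Proof.
apply: (leq_trans (size_sum _ _ _)); apply/bigmax_leqP => k _.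
rewrite (leq_trans (size_scale_leq _ _))//.
have -> : \prod_(j < K | j != k) ('X - (z j)%:P)
  = \prod_(x <- [seq z j | j <- index_enum 'I_K & j != k]) ('X - x%:P).
  by rewrite big_map big_filter.
rewrite size_prod_XsubC size_map ltnS size_filter.
by rewrite (leq_trans (count_size _ _))// -sum1_size sum_nat_const card_ord muln1.
Qed.

(** The roots are split at distance [r] from [lam]. Were fewer than [m] of them near, the near
    factors would form a polynomial of degree below [m], and the coefficient inequality applied to
    the far ones would contradict the last hypothesis. *)
Lemma root_tuple_near {R : realType} (p : {poly R[i]}) lam (r : R) m n :
  0 < r -> (0 < m)%N -> (size p <= n.+1)%N ->
  m.+1%:R ^+ n * \sum_(j < m) cmod (p \Po ('X + lam%:P))`_j * r ^+ j
    < cmod (p \Po ('X + lam%:P))`_m * r ^+ m ->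
  exists s : m.-tuple R[i], (forall x, (count_mem x s <= mup x p)%N)
    /\ forall x, x \in s -> cmod (x - lam) <= r.
Proof.
move=> r0 m0 sp lt_m.
have S0 : 0 <= \sum_(j < m) cmod (p \Po ('X + lam%:P))`_j * r ^+ j.
  by apply: sumr_ge0 => j _; rewrite mulr_ge0 ?cmod_ge0// exprn_ge0// ltW.
have p0 : p != 0.
  apply: contraTneq lt_m => p0; rewrite -leNgt {1}p0 comp_poly0 coef0.
  by rewrite Normc.normc0 mul0r mulr_ge0// exprn_ge0.
have [rs pE] := closed_field_poly_normal p.
have lc0 : lead_coef p != 0 by rewrite lead_coef_eq0.
have mup_p x : mup x p = count_mem x rs.
  by rewrite pE -mul_polyC mupMr ?mu_prod_XsubC// /root hornerC.
have size_rs : (size rs <= n)%N.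
  by move: sp; rewrite pE size_scale// size_prod_XsubC.
pose near x := cmod (x - lam) <= r.
have [le_m|lt_near] := leqP m (size [seq x <- rs | near x]).
  have st : size (take m [seq x <- rs | near x]) == m by rewrite size_takel.
  exists (Tuple st) => /=; split=> [x|x /mem_take]; last first.
    by rewrite mem_filter => /andP[].
  rewrite mup_p (@leq_trans (count_mem x [seq x <- rs | near x]))//.
    by rewrite -{2}(cat_take_drop m [seq x <- rs | near x]) count_cat leq_addr.
  by rewrite count_filter; apply: sub_count => y /andP[].
pose lin x : {poly R[i]} := 'X - (x - lam)%:P.
have sE : p \Po ('X + lam%:P) = (lead_coef p *: \prod_(x <- [seq x <- rs | near x]) lin x)
    * \prod_(x <- [seq x - lam | x <- [seq x <- rs | ~~ near x]]) ('X - x%:P).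
  rewrite {1}pE comp_polyZ rmorph_prod/= big_map -scalerAl; congr (_ *: _).
  rewrite (bigID near)/= !big_filter; congr (_ * _); apply: eq_bigr => x _;
    by rewrite comp_polyB comp_polyX comp_polyC /lin polyCB opprB addrA addrAC.
have coef_m : (lead_coef p *: \prod_(x <- [seq x <- rs | near x]) lin x)`_m = 0.
  rewrite nth_default// (leq_trans (size_scale_leq _ _))//.
  have -> : \prod_(x <- [seq x <- rs | near x]) lin x
    = \prod_(x <- [seq x - lam | x <- [seq x <- rs | near x]]) ('X - x%:P).
    by rewrite big_map.
  by rewrite size_prod_XsubC size_map.
have far x : x \in [seq x - lam | x <- [seq x <- rs | ~~ near x]] -> r <= cmod x.
  move=> /mapP[y]; rewrite mem_filter => /andP[/=] + _ ->.
  by rewrite /near -ltNge => /ltW.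
have := coef_mul_large_roots _ _ _ _ r0 m0 coef_m far.
rewrite -sE leNgt => /negP[]; apply: le_lt_trans lt_m.
rewrite ler_wpM2r// ler_eXn2l ?ltr1n//.
by rewrite size_map size_filter (leq_trans (count_size _ _)).
Qed.

(** * Degree bounds and perturbation of the coefficients *)

Lemma mup_leq_size {F : fieldType} (p : {poly F}) x :
  (mup x p <= (size p).-1)%N.
Proof.
have [->|p0] := eqVneq p 0.
  by rewrite /mup; case: arg_maxnP => [|[l]]; rewrite ?expr0 ?dvd1p//= size_poly0.
have := leqnn (mup x p); rewrite mup_geq// => /(dvdp_leq p0).
by rewrite size_exp_XsubC; case: size.
Qed.

(** Allows constants in [K] to dominate those in the multiplicity, and yields [0 < K] at a root. *)
Lemma root_mult_leq {R : realType} {K : nat} (z w : 'I_K -> R[i]) lam :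
  (root_mult z w lam <= K)%N.
Proof.
rewrite (leq_trans (leq_subr _ _))// (leq_trans (mup_leq_size _ _))//.
by case: (size _) (size_bary_num z w).
Qed.

Lemma bary_cond_sum {R : realType} {K : nat} (z w : 'I_K -> R[i]) lam :
  bary z w lam = cond_sum z w lam 0.
Proof. by apply: eq_bigr => k _; rewrite expr1. Qed.

(** The coefficients are linear in the weights, so [N] depends on [z], [lam] and [n] only; it sums
    over all [j < n] to serve every index at once. *)
Lemma coef_bary_num_lipschitz {R : realType} {K : nat} (z : 'I_K -> R[i]) lam n :
  exists2 N : R, 0 <= N & forall w what e j, (j < n)%N ->
    (forall k, cmod (what k - w k) <= e) ->
    cmod ((bary_num z what \Po ('X + lam%:P))`_j
          - (bary_num z w \Po ('X + lam%:P))`_j) <= e * N.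
Proof.
pose Dk k := (\prod_(j < K | j != k) ('X - (z j)%:P)) \Po ('X + lam%:P).
pose N := \sum_(j < n) \sum_(k < K) cmod (Dk k)`_j.
exists N => [|w what e j jn we].
  by do 2!apply: sumr_ge0 => ? _; exact: cmod_ge0.
have coefE v : (bary_num z v \Po ('X + lam%:P))`_j = \sum_(k < K) v k * (Dk k)`_j.
  rewrite /bary_num rmorph_sum/= coef_sum; apply: eq_bigr => k _.
  by rewrite comp_polyZ coefZ.
rewrite !coefE -sumrB (le_trans (ler_cmod_sum _ _))//.
apply: (@le_trans _ _ (\sum_(k < K) e * cmod (Dk k)`_j)).
  by apply: ler_sum => k _; rewrite -mulrBl Normc.normcM ler_wpM2r ?cmod_ge0.
rewrite -mulr_sumr.
(* The sign of [e] is read off from one of the weight bounds, which exist only for [0 < K]. *)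
have [K0|K0] := posnP K.
  by rewrite /N; subst K; rewrite big_ord0 mulr0 big1 ?mulr0// => i _; rewrite big_ord0.
have e0 : 0 <= e by apply: le_trans (we (Ordinal K0)); exact: cmod_ge0.
rewrite ler_wpM2l// /N (bigD1 (Ordinal jn))//= lerDl.
by do 2!apply: sumr_ge0 => ? _; exact: cmod_ge0.
Qed.

(** As [bary z w lam = 0], only the sum of [(what k - w k) / (lam - z k)] remains. This explicit
    bound, in place of [N], is the source of [min_dist] in [kappa] and keeps the final constant
    independent of [z], [w] and [lam]. *)
Lemma coef0_bary_num_perturb {R : realType} {K : nat} (z w what : 'I_K -> R[i])
    lam e :
  (forall k, lam != z k) -> bary z w lam = 0 ->
  (forall k, cmod (what k - w k) <= e) -> 0 < min_dist z lam ->
  cmod (bary_num z what \Po ('X + lam%:P))`_0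
    <= cmod (bary_den z).[lam] * (K%:R * e / min_dist z lam).
Proof.
move=> lz w0 we d0.
rewrite coef_shift_bary_num// mul1r -bary_cond_sum Normc.normcM.
rewrite ler_wpM2l ?cmod_ge0// -[bary z what lam]subr0 -w0 -sumrB.
rewrite (le_trans (ler_cmod_sum _ _))//.
rewrite (le_trans (ler_sum _ (G := fun=> e / min_dist z lam) _))//.
  move=> k _; rewrite -mulrBl Normc.normcM Normc.normcV.
  rewrite ler_pM ?invr_ge0 ?cmod_ge0// lef_pV2 ?min_dist_le// posrE//.
  by rewrite cmod_gt0 subr_eq0.
by rewrite sumr_const card_ord -mulrA mulr_natl.
Qed.

(* The hypotheses on [u] say that it is small: the first makes the [m]-th
   coefficient of the perturbed numerator at least half of the original one,
   the last makes the coefficients of index [0 < j < m] negligible. *)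
Lemma perturbed_roots {R : realType} {K : nat} (C : R) (z w what : 'I_K -> R[i])
    lam m (N u r : R)
    (d := min_dist z lam) (e := cmod (cond_sum z w lam m))
    (D := cmod (bary_den z).[lam])
    (c := 2 * (K.+1%:R ^+ K * (K%:R * C + 1)) + 1) :
  0 < C -> 0 <= N -> 0 < u ->
  (forall k, lam != z k) -> (0 < m)%N -> root_mult z w lam = m ->
  (forall k, cmod (what k - w k) <= C * u) ->
  (forall j, (j < m.+1)%N ->
    cmod ((bary_num z what \Po ('X + lam%:P))`_j
          - (bary_num z w \Po ('X + lam%:P))`_j) <= C * u * N) ->
  2 * (C * u * N) <= D * e ->
  0 < r -> r ^+ m = c ^+ m * (u / (d * e)) ->
  r <= 1 -> r < d -> m%:R * (C * N * r * d) <= D ->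
  exists s : m.-tuple R[i],
    (forall x, (count_mem x s <= root_mult z what x)%N)
    /\ forall x, x \in s -> cmod (x - lam) <= r.
Proof.
move=> C0 N0 u0 lz m0 wm we wN small_u r0 rm r1 rd small_r.
have [ei em] := cond_sum_root_mult _ _ _ _ lz m0 wm.
have mK : (m <= K)%N by rewrite -wm root_mult_leq.
have d0 : 0 < d by rewrite min_dist_gt0// (leq_trans m0).
have e0 : 0 < e by rewrite cmod_gt0.
have D0 : 0 < D by rewrite cmod_gt0 bary_den_neq0.
set p := bary_num z what \Po ('X + lam%:P) in wN *.
have p0 : cmod p`_0 <= D * (K%:R * (C * u) / d).
  by rewrite (coef0_bary_num_perturb _ w)// bary_cond_sum ei.
have pj j : (0 < j < m)%N -> cmod p`_j <= C * u * N.
  move=> /andP[_ jm]; have := wN j (ltnW jm).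
  rewrite (coef_shift_bary_num _ w)//; last by move=> i /ltn_trans-/(_ _ jm)/ei.
  by rewrite ei// !mulr0 subr0.
have pm : D * e <= 2 * cmod p`_m.
  have := wN m (ltnSn m); rewrite (coef_shift_bary_num _ w)//.
  set a := _ * (_ * _) => wm_le.
  have aE : cmod a = D * e.
    rewrite !Normc.normcM cmodX cmodN Normc.normc1 expr1n mul1r//.
  have : cmod a <= cmod p`_m + cmod (p`_m - a).
    by rewrite -{1}(subKr p`_m a) ler_cmodB.
  by rewrite aE; lra.
(* Index 0 gives the term in [K%:R * C]; the others, with [r ^+ j <= r], add at most [D * (u / d)]
   by [small_r]. *)
have low : \sum_(j < m) cmod p`_j * r ^+ j <= D * ((K%:R * C + 1) * (u / d)).
  apply: (@le_trans _ _ (D * (K%:R * (C * u) / d) + m%:R * (C * u * N * r))).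
    case: (m) m0 pj => // m' _ pj.
    rewrite big_ord_recl/= mulr1 lerD// -natr1 mulrDl mul1r.
    rewrite (le_trans (ler_sum _ (G := fun=> C * u * N * r) _))//.
      move=> i _; rewrite ler_pM ?cmod_ge0 ?exprn_ge0 ?(ltW r0)//.
        by rewrite pj/= ?/bump/= ?add1n ?ltnS.
      by rewrite /bump/= add1n exprS ler_piMr ?(ltW r0)// exprn_ile1// ltW.
    rewrite sumr_const card_ord mulr_natl lerDl.
    by rewrite !mulr_ge0// ltW.
  have -> : D * ((K%:R * C + 1) * (u / d))
    = D * (K%:R * (C * u) / d) + D * (u / d) by ring.
  rewrite lerD2l [leRHS]mulrA ler_pdivlMr//.
  have := ler_wpM2l (ltW u0) small_r.
  by rewrite [u * D]mulrC; apply: le_trans; rewrite le_eqVlt; apply/orP; left;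
     apply/eqP; ring.
have c1 : 1 <= c.
  rewrite /c lerDr !mulr_ge0// ?exprn_ge0// addr_ge0// mulr_ge0//.
  exact: ltW.
have top : m.+1%:R ^+ K * (D * ((K%:R * C + 1) * (u / d))) < cmod p`_m * r ^+ m.
  rewrite rm.
  have ud0 : 0 < u / d by rewrite divr_gt0.
  (* Only one factor of [c ^+ m] is kept, which [1 <= c] permits, so that the comparison does not
     depend on [m]. *)
  apply: (@lt_le_trans _ _ (D * e / 2 * (c * (u / (d * e))))); last first.
    have c0 : 0 <= c by rewrite (le_trans ler01).
    have ude0 : 0 <= u / (d * e) by rewrite ltW// divr_gt0// mulr_gt0.
    rewrite ler_pM ?[0 <= c * _]mulr_ge0//.
    - by rewrite ltW// divr_gt0// mulr_gt0.
    - by rewrite ler_pdivrMr// [leRHS]mulrC.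
    - by rewrite ler_wpM2r// -[leLHS]expr1 ler_weXn2l.
  have -> : D * e / 2 * (c * (u / (d * e))) = D * (u / d) * (c / 2).
    by field; rewrite !gt_eqF.
  have -> : m.+1%:R ^+ K * (D * ((K%:R * C + 1) * (u / d)))
    = D * (u / d) * (m.+1%:R ^+ K * (K%:R * C + 1)) by ring.
  rewrite ltr_pM2l ?(mulr_gt0 D0)//.
  have : m.+1%:R ^+ K * (K%:R * C + 1) <= K.+1%:R ^+ K * (K%:R * C + 1).
    rewrite ler_wpM2r ?addr_ge0 ?mulr_ge0 ?(ltW C0)//.
    by rewrite lerXn2r ?nnegrE// ler_nat.
  by rewrite /c; lra.
have [s [s_mup s_near]] := root_tuple_near _ lam _ _ _ r0 m0 (size_bary_num z what)
  (le_lt_trans (ler_wpM2l (exprn_ge0 K (ler0n R m.+1)) low) top).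
exists s; split=> // x; have [xs|] := boolP (x \in s); last first.
  by move=> /count_memPn ->.
(* [r < d] keeps the roots found away from every [z k], so none of them is cancelled by the
   denominator. *)
rewrite root_multE// => k; apply: contraTneq (rd) => xzk.
rewrite -leNgt (le_trans (min_dist_le z lam k))//.
by rewrite -xzk -cmodN opprB s_near.
Qed.

(** [c] is fixed before the data and so depends on [K] and [C] alone; the range of [u] may vary with
    the data but not with [what]. The bound on [count_mem] expresses counting with multiplicity. *)
Theorem theorem4p4 (R : realType) (K : nat) (C : R) (hC : 0 < C) :
  exists2 c : R, 0 < c &
  forall (z w : 'I_K -> R[i]) (lam : R[i]) (m : nat),
    \sum_(k < K) cmod (w k) ^+ 2 = 1 ->
    (forall k, lam != z k) ->
    (0 < m)%N ->
    root_mult z w lam = m ->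
    [/\ 0 < kappa z w lam m,
        kappa z w lam m ^- m
        = min_dist z lam * cmod (\sum_(k < K) w k / (lam - z k) ^+ m.+1),
        min_dist z lam * cmod (\sum_(k < K) w k / (lam - z k) ^+ m.+1)
        = min_dist z lam
          * cmod ((bary z w : R[i] -> R[i]^o)^`(m)%classic lam / (m`!)%:R)
      & \forall u \near 0^'+, forall what : 'I_K -> R[i],
          (forall k, cmod (what k - w k) <= C * u) ->
          exists lamhat : m.-tuple R[i],
            (forall x, (count_mem x lamhat <= root_mult z what x)%N) /\
            (forall j : 'I_m, cmod (tnth lamhat j - lam)
                              <= c * (kappa z w lam m * u `^ (m%:R^-1)))].
Proof.
(* [K.+1%:R ^+ K] dominates [m.+1%:R ^+ K], [K%:R * C] comes from the constant coefficient, the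
   inner 1 from the middle ones; the 2 offsets halving the top coefficient and the outer 1 gives
   strictness. *)
set c := 2 * (K.+1%:R ^+ K * (K%:R * C + 1)) + 1.
have c0 : 0 < c.
  rewrite ltr_wpDl// !mulr_ge0// ?exprn_ge0// addr_ge0// mulr_ge0//.
  exact: ltW.
exists c => // z w lam m _ lz m0 wm.
have [_ em] := cond_sum_root_mult _ _ _ _ lz m0 wm.
have d0 : 0 < min_dist z lam.
  by rewrite min_dist_gt0// (leq_trans m0)// -wm root_mult_leq.
have e0 : 0 < cmod (cond_sum z w lam m) by rewrite cmod_gt0.
have de0 := mulr_gt0 d0 e0.
have k0 := kappa_gt0 _ _ _ _ de0.
have kX := kappaXn _ _ _ _ m0 de0.
split=> //; first by rewrite kX invrK.
  rewrite derive1n_bary// mulrAC mulfK ?pnatr_eq0 -?lt0n ?fact_gt0//.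
  by rewrite [in RHS]Normc.normcM cmodX cmodN Normc.normc1 expr1n mul1r.
set d := min_dist z lam in d0 de0 kX *.
set e := cmod (cond_sum z w lam m) in e0 de0 kX.
set k := kappa z w lam m in k0 kX *.
have [N N0 lipN] := coef_bary_num_lipschitz z lam m.+1.
have D0 : 0 < cmod (bary_den z).[lam] by rewrite cmod_gt0 bary_den_neq0.
set D := cmod (bary_den z).[lam] in D0.
have CN0 : 0 <= C * N by rewrite mulr_ge0// ltW.
have mCNd0 : 0 <= m%:R * (C * N * d) by rewrite !mulr_ge0// ltW.
(* The three bounds on [r] demanded by [perturbed_roots]; the [+ 1] avoids a zero denominator when
   [N = 0]. *)
pose eps := Num.min (Num.min 1 d) (D / (m%:R * (C * N * d) + 1)).
have eps0 : 0 < eps.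
  by rewrite !lt_min ltr01 d0 divr_gt0// ltr_wpDl.
have eta0 : 0 < eps / (c * k) by rewrite divr_gt0// mulr_gt0.
near=> u => what we.
have u0 : 0 < u by near: u; exact: nbhs_right_gt.
(* This is [r < eps] for [r = c * (k * v)], after taking [m]-th powers. *)
have u_eta : u < (eps / (c * k)) ^+ m.
  by near: u; apply: nbhs_right_lt; rewrite exprn_gt0.
have u_De : u < D * e / (2 * (C * N) + 1).
  near: u; apply: nbhs_right_lt; rewrite divr_gt0 ?mulr_gt0// ltr_wpDl//.
  by rewrite mulr_ge0.
set v := u `^ m%:R^-1.
have v0 : 0 < v by exact: powR_gt0.
have vm : v ^+ m = u.
  by rewrite -powR_mulrn ?powR_ge0// -powRrM mulVf ?powRr1 ?ltW// pnatr_eq0 -lt0n.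
pose r := c * (k * v).
have r0 : 0 < r by rewrite !mulr_gt0.
have r_eps : r < eps.
  rewrite /r mulrA mulrC -ltr_pdivlMr ?mulr_gt0//.
  by rewrite -(ltr_pXn2r m0) ?nnegrE ?(ltW v0) ?(ltW eta0)// vm.
have /andP[/andP[r1 rd] rD] : (r < 1) && (r < d)
    && (r < D / (m%:R * (C * N * d) + 1)) by rewrite -!lt_min.
have small_u : 2 * (C * u * N) <= D * e.
  move: u_De; rewrite ltr_pdivlMr ?ltr_wpDl ?mulr_ge0//; lra.
have small_r : m%:R * (C * N * r * d) <= D.
  move: rD; rewrite ltr_pdivlMr ?ltr_wpDl//; lra.
have rm : r ^+ m = c ^+ m * (u / (d * e)).
  by rewrite /r !exprMn vm kX [_^-1 * u]mulrC.
have [s [s_mup s_near]] := perturbed_roots C z w what lam m N u r hC N0 u0 lz m0 wm we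
  (fun j jm => lipN w what (C * u) j jm we) small_u r0 rm (ltW r1) rd small_r.
by exists s; split=> // j; apply: s_near; exact: mem_tnth.
Unshelve. all: by end_near.
Qed.
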